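(* Let $M$ and $N$ be objects of an abelian category $\mathcal{A}$, $M'$ a direct summand of $M$ and $N'$ a direct summand of $N$. (1) If $N$ is strongly $M$-CS-Rickart, then $N'$ is strongly $M'$-CS-Rickart. (2) If $N$ is dual strongly $M$-CS-Rickart, then $N'$ is dual strongly $M'$-CS-Rickart.
   Context: Let $\mathcal{A}$ be an abelian category. A monomorphism $f:K\to M$ is essential if, for every morphism $h:M\to P$, $hf$ monomorphism implies $h$ monomorphism; it is fully invariant if for every $h:M\to M$ there is $\alpha:K\to K$ with $hf=f\alpha$. An epimorphism $g:M\to N$ is superfluous if, for every morphism $h:Q\to M$, $gh$ epimorphism implies $h$ epimorphism; it is fully coinvariant if for every $h:M\to M$ there is $\beta:N\to N$ with $gh=\beta g$. A section is a morphism with a left inverse; a retraction is a morphism with a right inverse. For objects $M,N$ of $\mathcal{A}$: $N$ is strongly $M$-CS-Rickart if for every $f:M\to N$ there are an essential monomorphism $e:{\rm Ker}(f)\to L$ and a fully invariant section $s:L\to M$ with ${\rm ker}(f)=se$. $N$ is dual strongly $M$-CS-Rickart if for every $f:M\to N$ there are a fully coinvariant retraction $r:N\to P$ and a superfluous epimorphism $t:P\to{\rm Coker}(f)$ with ${\rm coker}(f)=tr$. *)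

(* Defs.v *)
From mathcomp Require Import all_boot all_algebra.
From mathcomp Require Import boolp.
Set Implicit Arguments.
Unset Strict Implicit.
Unset Printing Implicit Defensive.
Import GRing.Theory.
Local Open Scope ring_scope.

(* [comp g f] is "g after f". *)
Record preadditiveCategory := PreadditiveCategory {
  Obj :> Type;
  Hom : Obj -> Obj -> zmodType;
  idm : forall M, Hom M M;
  comp : forall M N P, Hom N P -> Hom M N -> Hom M P;
  compA : forall M N P Q (h : Hom P Q) (g : Hom N P) (f : Hom M N),
    comp h (comp g f) = comp (comp h g) f;
  comp1m : forall M N (f : Hom M N), comp (idm N) f = f;
  compm1 : forall M N (f : Hom M N), comp f (idm M) = f;
  compDl : forall M N P (g g' : Hom N P) (f : Hom M N),
    comp (g + g') f = comp g f + comp g' f;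
  compDr : forall M N P (g : Hom N P) (f f' : Hom M N),
    comp g (f + f') = comp g f + comp g f'
}.

Arguments Hom {_} _ _.
Arguments idm {_} _.
Arguments comp {_ _ _ _} _ _.

Notation "g ∘ f" := (comp g f) (at level 40, left associativity) : ring_scope.

Section Preadditive.
Variable C : preadditiveCategory.
Implicit Types A B S K M N P Q X Z : C.

Definition mono M N (f : Hom M N) : Prop :=
  forall X (u v : Hom X M), f ∘ u = f ∘ v -> u = v.

Definition epi M N (g : Hom M N) : Prop :=
  forall X (u v : Hom N X), u ∘ g = v ∘ g -> u = v.

Definition section M N (s : Hom M N) : Prop :=
  exists r : Hom N M, r ∘ s = idm M.

Definition retraction M N (r : Hom M N) : Prop :=
  exists s : Hom N M, r ∘ s = idm N.

Definition zero_object Z : Prop :=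
  (forall X (f g : Hom X Z), f = g) /\ (forall X (f g : Hom Z X), f = g).

Definition is_biproduct A B S (iA : Hom A S) (iB : Hom B S)
    (pA : Hom S A) (pB : Hom S B) : Prop :=
  [/\ pA ∘ iA = idm A, pB ∘ iB = idm B, pB ∘ iA = 0, pA ∘ iB = 0
    & iA ∘ pA + iB ∘ pB = idm S].

Definition direct_sum A B S : Prop :=
  exists (iA : Hom A S) (iB : Hom B S) (pA : Hom S A) (pB : Hom S B),
    is_biproduct iA iB pA pB.

Definition direct_summand (M' M : C) : Prop := exists M'' : C, direct_sum M' M'' M.

Definition is_kernel M N (f : Hom M N) K (k : Hom K M) : Prop :=
  f ∘ k = 0 /\
  forall X (x : Hom X M), f ∘ x = 0 -> exists! y : Hom X K, k ∘ y = x.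

Definition is_cokernel M N (f : Hom M N) Q (q : Hom N Q) : Prop :=
  q ∘ f = 0 /\
  forall X (x : Hom N X), x ∘ f = 0 -> exists! y : Hom Q X, y ∘ q = x.

Definition essential K M (f : Hom K M) : Prop :=
  mono f /\ forall P (h : Hom M P), mono (h ∘ f) -> mono h.

Definition superfluous M N (g : Hom M N) : Prop :=
  epi g /\ forall Q (h : Hom Q M), epi (g ∘ h) -> epi h.

Definition fully_invariant K M (f : Hom K M) : Prop :=
  mono f /\ forall h : Hom M M, exists alpha : Hom K K, h ∘ f = f ∘ alpha.

Definition fully_coinvariant M N (g : Hom M N) : Prop :=
  epi g /\ forall h : Hom M M, exists beta : Hom N N, g ∘ h = beta ∘ g.

End Preadditive.

Record abelianCategory := AbelianCategory {
  preadditive_of :> preadditiveCategory;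
  has_zero_object : exists Z : preadditive_of, zero_object Z;
  has_direct_sums : forall A B : preadditive_of, exists S, direct_sum A B S;
  has_kernels : forall (M N : preadditive_of) (f : Hom M N),
    exists K (k : Hom K M), is_kernel f k;
  has_cokernels : forall (M N : preadditive_of) (f : Hom M N),
    exists Q (q : Hom N Q), is_cokernel f q;
  mono_normal : forall (K M : preadditive_of) (k : Hom K M),
    mono k -> exists N (f : Hom M N), is_kernel f k;
  epi_normal : forall (N Q : preadditive_of) (q : Hom N Q),
    epi q -> exists M (f : Hom M N), is_cokernel f q
}.

Section Abelian.
Variable A : abelianCategory.

Definition Ker (M N : A) (f : Hom M N) : A := sval (cid (has_kernels f)).

Definition ker (M N : A) (f : Hom M N) : Hom (Ker f) M :=
  sval (cid (svalP (cid (has_kernels f)))).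

Definition Coker (M N : A) (f : Hom M N) : A := sval (cid (has_cokernels f)).

Definition coker (M N : A) (f : Hom M N) : Hom N (Coker f) :=
  sval (cid (svalP (cid (has_cokernels f)))).

Lemma ker_is_kernel (M N : A) (f : Hom M N) : is_kernel f (ker f).
Proof. exact: svalP (cid (svalP (cid (has_kernels f)))). Qed.

Lemma coker_is_cokernel (M N : A) (f : Hom M N) : is_cokernel f (coker f).
Proof. exact: svalP (cid (svalP (cid (has_cokernels f)))). Qed.

(* The first argument is the subscript object: this says that [N] is strongly
   [M]-CS-Rickart. *)
Definition strongly_CS_Rickart (M N : A) : Prop :=
  forall f : Hom M N, exists (L : A) (e : Hom (Ker f) L) (s : Hom L M),
    [/\ essential e, section s, fully_invariant s & ker f = s ∘ e].

(* Same argument order: [N] is dual strongly [M]-CS-Rickart. *)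
Definition dual_strongly_CS_Rickart (M N : A) : Prop :=
  forall f : Hom M N, exists (P : A) (r : Hom N P) (t : Hom P (Coker f)),
    [/\ retraction r, fully_coinvariant r, superfluous t & coker f = t ∘ r].

End Abelian.

(* Main.v *)
Require Import Defs.
From mathcomp Require Import all_boot all_algebra.

(** Write [M = M' ⊕ M''] with structure maps [i], [j], [p], [q], let [i'] be the
    inclusion of [N'] in [N], and let [f : M' -> N'].  The kernel of
    [g = i' f p : M -> N] is [Ker f ⊕ M''], and it is essential in some fully
    invariant summand [L] of [M].  As [L] contains [M''], it splits as
    [L' ⊕ M''] with [L' = L ∩ M'] (the kernel of [q] on [L]), and [L'] is the
    required fully invariant summand of [M'].  For the essentiality of [Ker f]
    in [L'], extend [h : L' -> P] to [h ⊕ 1 : L' ⊕ M'' -> P ⊕ M''].  The second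
    part is the first one in the opposite category. *)

Set Implicit Arguments.
Unset Strict Implicit.
Unset Printing Implicit Defensive.
Import GRing.Theory Defs.
Local Open Scope ring_scope.

Section PreadditiveTheory.
Variable C : preadditiveCategory.
Implicit Types K L M N P X : C.

Lemma comp0m M N P (f : Hom M N) : (0 : Hom N P) ∘ f = 0.
Proof. by apply: (@addrI _ (0 ∘ f)); rewrite -compDl !addr0. Qed.

Lemma compm0 M N P (g : Hom N P) : g ∘ (0 : Hom M N) = 0.
Proof. by apply: (@addrI _ (g ∘ 0)); rewrite -compDr !addr0. Qed.

Lemma compNl M N P (g : Hom N P) (f : Hom M N) : (- g) ∘ f = - (g ∘ f).
Proof. by apply: (@addrI _ (g ∘ f)); rewrite -compDl !subrr comp0m. Qed.

Lemma compNr M N P (g : Hom N P) (f : Hom M N) : g ∘ (- f) = - (g ∘ f).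
Proof. by apply: (@addrI _ (g ∘ f)); rewrite -compDr !subrr compm0. Qed.

Lemma mono_eq0 M N (f : Hom M N) :
  mono f <-> forall X (x : Hom X M), f ∘ x = 0 -> x = 0.
Proof.
split=> [fm X x fx0|f0 X u v fuv]; first by apply: fm; rewrite fx0 compm0.
by apply/eqP; rewrite -subr_eq0; apply/eqP/f0; rewrite compDr compNr fuv subrr.
Qed.

Lemma mono_compr M N P (g : Hom N P) (f : Hom M N) : mono (g ∘ f) -> mono f.
Proof. by move=> gfm X u v fuv; apply: gfm; rewrite -!compA fuv. Qed.

Lemma section_mono M N (s : Hom M N) : section s -> mono s.
Proof.
move=> [r rs1]; apply: (mono_compr (g := r)).
by rewrite rs1 => X u v; rewrite !comp1m.
Qed.

Lemma kernel_mono M N K (f : Hom M N) (k : Hom K M) : is_kernel f k -> mono k.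
Proof.
move=> [fk0 kU] X u v kuv.
have [|y [_ yU]] := kU X (k ∘ u); first by rewrite compA fk0 comp0m.
by rewrite -(yU u) // -(yU v).
Qed.

Lemma kernel_lift M N K (f : Hom M N) (k : Hom K M) X (x : Hom X M) :
  is_kernel f k -> f ∘ x = 0 -> exists y, k ∘ y = x.
Proof. by move=> [_ kU] /kU[y [ky _]]; exists y. Qed.

End PreadditiveTheory.

Lemma strongly_CS_Rickart_summand (A : abelianCategory) (M N M' N' : A) :
  direct_summand M' M -> direct_summand N' N ->
  strongly_CS_Rickart M N -> strongly_CS_Rickart M' N'.
Proof.
move=> [M'' [i [j [p [q [pi1 qj1 qi0 pj0 ijE]]]]]].
move=> [N'' [i' [j' [p' [q' [p'i'1 _ _ _ _]]]]]] MN f.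
have i'_mono : mono i' by apply: section_mono; exists p'.
have i_mono : mono i by apply: section_mono; exists p.
pose g := i' ∘ f ∘ p.
have [L [e [s [e_ess s_sec [s_mono s_inv] kgE]]]] := MN g.
have kgK := ker_is_kernel g; have kfK := ker_is_kernel f.
have ip_id X (x : Hom X M) : q ∘ x = 0 -> i ∘ (p ∘ x) = x.
  by move=> qx0; rewrite -[RHS]comp1m -ijE compDl -!compA qx0 compm0 addr0.
have [L' [l lK]] := has_kernels (q ∘ s); have l_mono := kernel_mono lK.
have isl : i ∘ (p ∘ s ∘ l) = s ∘ l.
  by rewrite -compA; apply: ip_id; rewrite compA; case: lK.
(* [p ∘ j = 0] puts [M''] inside the kernel of [g], hence inside [L]. *)
have [jL sjL] : exists jL, s ∘ jL = j.
  have [|j0 j0E] := kernel_lift (x := j) kgK.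
    by rewrite -compA pj0 compm0.
  by exists (e ∘ j0); rewrite compA -kgE.
(* [jL ∘ (q ∘ s)] is the idempotent of [L] onto [M'']. Its complement is killed by [q ∘ s], so it
   factors through [L']; this gives the projection [pL] along [M'']. *)
have [pL lpL] : exists pL, l ∘ pL = idm L - jL ∘ (q ∘ s).
  apply: (kernel_lift lK); rewrite compDr compNr compm1 -!compA.
  by rewrite (compA s) sjL (compA q) qj1 comp1m subrr.
have pLl : pL ∘ l = idm L'.
  apply: l_mono; rewrite compA lpL compDl comp1m compNl -compA lK.1 compm0.
  by rewrite subr0 compm1.
(* A left inverse is the inclusion of [M'] in [M], then a retraction onto [L], then [pL]. *)
have s'_sec : section (p ∘ s ∘ l).
  have [r rs1] := s_sec; exists (pL ∘ r ∘ i).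
  by rewrite -!(compA (pL ∘ r)) isl -compA (compA r) rs1 comp1m.
have s'_mono := section_mono s'_sec.
have [u uE] : exists u, ker g ∘ u = i ∘ ker f.
  apply: (kernel_lift kgK).
  by rewrite -!compA (compA p) pi1 comp1m kfK.1 compm0.
have [e' le'] : exists e', l ∘ e' = e ∘ u.
  apply: (kernel_lift lK).
  by rewrite -compA (compA s) -kgE uE compA qi0 comp0m.
have kfE : ker f = p ∘ s ∘ l ∘ e'.
  by rewrite -!compA le' (compA s) -kgE uE compA pi1 comp1m.
exists L', e', (p ∘ s ∘ l); split=> //; last first.
  (* An endomorphism [h] of [M'] is extended by zero on [M'']. The extension has image in [M'], so
     its restriction [al] to [L] lands in [L']. *)
  split=> // h; have [al sal] := s_inv (i ∘ h ∘ p).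
  have [be lbe] : exists be, l ∘ be = al ∘ l.
    apply: (kernel_lift lK); rewrite compA -(compA q) -sal.
    by rewrite -!compA (compA q) qi0 comp0m.
  exists be; rewrite -(compA _ l) lbe (compA _ al) -(compA p s al) -sal.
  by rewrite !compA pi1 comp1m.
split=> [|P h he'_mono].
  by apply: (mono_compr (g := p ∘ s ∘ l)); rewrite -kfE; apply: kernel_mono kfK.
have [S [a [b [c [d [ca1 db1 da0 cb0 _]]]]]] := has_direct_sums P M''.
(* Since [pL] and [q ∘ s] are the coordinates on [L], this is [h ⊕ 1]. *)
pose H := a ∘ (h ∘ pL) + b ∘ (q ∘ s).
have cH : c ∘ H = h ∘ pL by rewrite compDr !compA ca1 cb0 !comp0m comp1m addr0.
have dH : d ∘ H = q ∘ s by rewrite compDr !compA da0 db1 !comp0m comp1m add0r.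
have H_mono : mono H.
  (* By essentiality of [e], it is enough to test [H] on the kernel of [g]. An element [y] there
     with zero image lies in [L'], thus in the kernel of [f], where [h] is mono by assumption. *)
  apply: e_ess.2; apply/mono_eq0 => X y; rewrite -compA => Hey0.
  have hey0 : h ∘ pL ∘ (e ∘ y) = 0 by rewrite -cH -compA Hey0 compm0.
  have qsey0 : q ∘ s ∘ (e ∘ y) = 0 by rewrite -dH -compA Hey0 compm0.
  have [x lx] := kernel_lift lK qsey0.
  have hx0 : h ∘ x = 0 by rewrite -hey0 -lx -compA (compA pL) pLl comp1m.
  have kgy : p ∘ (ker g ∘ y) = p ∘ s ∘ l ∘ x.
    by rewrite kgE -!compA lx.
  have [z kfz] : exists z, ker f ∘ z = p ∘ (ker g ∘ y).
    apply: (kernel_lift kfK); apply: i'_mono.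
    by rewrite compm0 !compA kgK.1 comp0m.
  have xE : x = e' ∘ z by apply: s'_mono; rewrite -kgy -kfz kfE -compA.
  have x0 : x = 0.
    by rewrite xE ((mono_eq0 _).1 he'_mono _ z) ?compm0 // -compA -xE.
  apply: (kernel_mono kgK); rewrite compm0.
  by rewrite kgE -compA -lx x0 !compm0.
(* On [L'] the map [H] is [a ∘ h], so [h] inherits injectivity from [H]. *)
apply/mono_eq0 => X x hx0; apply: l_mono; apply: H_mono.
rewrite !compm0 compDl -!compA (compA pL) pLl comp1m hx0 compm0 add0r.
by rewrite (compA s) (compA q) (compA q) lK.1 comp0m compm0.
Qed.

Section Opposite.

Definition op_preadditive (C : preadditiveCategory) : preadditiveCategory :=
  @PreadditiveCategory C (fun M N => Hom N M) (@idm C)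
    (fun M N P g f => f ∘ g)
    (fun M N P Q h g f => esym (compA f g h))
    (fun M N f => compm1 f) (fun M N f => comp1m f)
    (fun M N P g g' f => compDr f g g') (fun M N P g f f' => compDl f f' g).

(** The biproduct equations are self-dual: injections and projections trade places. *)
Lemma op_direct_sum (C : preadditiveCategory) (X Y S : C) :
  direct_sum X Y S -> @direct_sum (op_preadditive C) X Y S.
Proof.
by move=> [iX [iY [pX [pY [? ? ? ? ?]]]]]; exists pX, pY, iX, iY.
Qed.

Variable A : abelianCategory.

Lemma op_has_zero_object : exists Z : op_preadditive A, zero_object Z.
Proof. by have [Z [? ?]] := has_zero_object A; exists Z. Qed.

Lemma op_has_direct_sums (X Y : op_preadditive A) : exists S, direct_sum X Y S.
Proof.
by have [S /op_direct_sum ?] := @has_direct_sums A X Y; exists S.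
Qed.

(* The chosen kernels of the opposite category are by construction the chosen
   cokernels of [A], so that the two Rickart conditions below differ only by the
   order of their components. *)
Definition op_abelian : abelianCategory :=
  @AbelianCategory (op_preadditive A) op_has_zero_object op_has_direct_sums
    (fun M N f => @has_cokernels A N M f) (fun M N f => @has_kernels A N M f)
    (fun K M k => @epi_normal A M K k) (fun N Q q => @mono_normal A Q N q).

Lemma op_strongly_CS_Rickart (M N : A) :
  @strongly_CS_Rickart op_abelian N M <-> dual_strongly_CS_Rickart M N.
Proof.
by split=> MN f; have [L [x [y [? ? ? ?]]]] := MN f; exists L, y, x.
Qed.

Lemma op_direct_summand (M' M : A) :
  direct_summand M' M -> @direct_summand op_abelian M' M.
Proof. by move=> [M'' /op_direct_sum ?]; exists M''. Qed.

End Opposite.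

Theorem corollary3p2 (A : abelianCategory) (M N M' N' : A)
    (hM : direct_summand M' M) (hN : direct_summand N' N) :
  (strongly_CS_Rickart M N -> strongly_CS_Rickart M' N') /\
  (dual_strongly_CS_Rickart M N -> dual_strongly_CS_Rickart M' N').
Proof.
split; first exact: strongly_CS_Rickart_summand.
move=> /op_strongly_CS_Rickart MN; apply/op_strongly_CS_Rickart.
by apply: strongly_CS_Rickart_summand MN; apply: op_direct_summand.
Qed.
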